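(* Let $Y$ be a stratifiable space, $X$ a closed subset of $Y$, and $a,b$ two distinct points of $X$. Let $d\le 1$ be a continuous metric on $Y$ with $d(y,X)>0$ for all $y\in Y\setminus X$; if $Y$ is metrizable, let $d$ in addition be an admissible metric for $Y$. Put $$d^*(y,y')=\min\{d(y,y'),\,d(y,X)+d(y',X)\},\qquad y,y'\in Y.$$ Let $u:Y\to\exp_\omega X$ be an upper-semicontinuous map with $u(x)=\{x\}$ for $x\in X$, and let $h:Y\to \mathsf{HM}(X)$ be a continuous map extending the identity embedding $X\hookrightarrow\mathsf{HM}(X)$ with $\operatorname{supp}(h(y))\subset u(y)$ for every $y\in Y$; if $Y$ is metrizable, let $u$ moreover satisfy $u(y)\subset\{z\in Y: d(z,y)<2d(y,X)\}$ for every $y\in Y\setminus X$. For $p\in\mathbb{R}^{X\times X}$ and $y,y'\in Y$ define $$S(p)(y,y')=\int_0^1 p(h(y)(t),h(y')(t))\,dt,$$ $$S_1(p)=S(p)+p(a,b)\,d^*,\qquad S_2(p)=S(p)+(p(a,b)-p(a,a))\,d^*.$$ Then $S,S_1,S_2:\mathbb{R}^{X\times X}\to\mathbb{R}^{Y\times Y}$ are linear extension operators, each of them continuous with respect to each of the three topologies (point-wise convergence, uniform, and compact-open), and: (i) $S$ is positive and preserves constant functions, bounded functions, continuous functions, and pseudometrics, but $S$ does not preserve metrics; (ii) $S_1$ is positive and preserves bounded functions, continuous functions, pseudometrics, and metrics, but $S_1$ fails to preserve constant functions; (iii) $S_2$ preserves constant functions, bounded functions, continuous functions, pseudometrics, and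 metrics, but $S_2$ is not positive. Moreover, if the space $Y$ is metrizable, then the operators $S_1$ and $S_2$ preserve dominating metrics and admissible metrics.
   Context: A $T_1$ topological space $Y$ is stratifiable if to each open $U\subset Y$ one can assign a sequence $(U_n)_{n\in\mathbb{N}}$ of open subsets of $Y$ such that $\overline{U_n}\subset U$ for all $n$, $\bigcup_n U_n=U$, and $U_n\subset V_n$ for all $n$ whenever $U\subset V$ are open. For a metric $d$, $d(y,X)=\inf\{d(y,x):x\in X\}$. $\exp_\omega X$ is the set of finite subsets of $X$; a map $u:Y\to\exp_\omega X$ is upper-semicontinuous if for every open $U\subset X$ the set $\{y\in Y: u(y)\subset U\}$ is open in $Y$. Hartman–Mycielski space: $\mathsf{HM}_n(X)$ is the set of all functions $f:[0,1)\to X$ for which there is a sequence $0=a_0<a_1<\dots<a_n=1$ with $f$ constant on each $[a_{i-1},a_i)$, $1\le i\le n$, and $\mathsf{HM}(X)=\bigcup_{n\in\mathbb{N}}\mathsf{HM}_n(X)$. A neighborhood sub-base of the topology of $\mathsf{HM}(X)$ at $f$ consists of the sets $N(a',b',V,\varepsilon)=\{g\in\mathsf{HM}(X): |\{t\in[a',b'): g(t)\notin V\}|<\varepsilon\}$, where $0\le a'<b'\le1$, $f$ is constant on $[a',b')$, $V$ is a neighborhood of $f(a')$ in $X$, $\varepsilon>0$, and $|\cdot|$ is Lebesgue measure. $X$ is identified with $\mathsf{HM}_1(X)$ (constant functions), and $\operatorname{supp}(f)=f([0,1))$. For a space $Z$, $\mathbb{R}^Z$ is the linear space of all (not necessarily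 continuous) real-valued functions on $Z$. The topology of point-wise convergence is the Tychonoff product topology; the uniform topology is that of uniform convergence on $Z$; the compact-open topology on $\mathbb{R}^Z$ is understood as the topology of uniform convergence on compact subsets of $Z$. Continuity of an operator is with respect to the same type of topology on domain and range. An operator $T:\mathbb{R}^{X\times X}\to\mathbb{R}^{Y\times Y}$ is positive if $T(p)\ge 0$ whenever $p\ge0$, and is an extension operator if $T(p)|_{X\times X}=p$ for all $p$. ''$T$ preserves'' a class of functions means that $T$ carries every function on $X\times X$ of this class to a function on $Y\times Y$ of the same class; since $T$ is an extension operator, preserving constant functions means that a constant function is carried to the constant function with the same value. Metrics and pseudometrics are functions satisfying the usual axioms, not assumed continuous. A metric $d$ on a topological space $Z$ is dominating if the formal identity map $(Z,d)\to Z$ is continuous, and admissible if it is continuous and dominating.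
   Formalization: ''S₁ fails to preserve constants'' and ''S₂ is not positive'' are claimed only for X ≠ Y (false if X = Y); ''S does not preserve metrics'' (false for injective h) is claimed whenever h is not injective, and, if X ≠ Y, for some admissible choice of u, h with the same d. *)

(* Defs.v *)
From HB Require Import structures.
From mathcomp Require Import all_boot all_order all_algebra.
From mathcomp Require Import finmap all_classical all_reals all_analysis.

Set Implicit Arguments.
Unset Strict Implicit.
Unset Printing Implicit Defensive.

Import Order.TTheory GRing.Theory Num.Theory.
Import numFieldNormedType.Exports.

Local Open Scope classical_set_scope.
Local Open Scope ring_scope.

Section Metrics.
Variables (R : realType) (Z : topologicalType).
Implicit Types d : Z * Z -> R.

Definition pseudometric d :=
  [/\ forall x y, 0 <= d (x, y),
      forall x, d (x, x) = 0,
      forall x y, d (x, y) = d (y, x) &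
      forall x y z, d (x, z) <= d (x, y) + d (y, z)].

(* As for pseudometrics, no continuity on the topological space Z is assumed. *)
Definition metric d :=
  pseudometric d /\ forall x y, d (x, y) = 0 -> x = y.

Definition metric_open d (U : set Z) :=
  forall x, U x -> exists2 e : R, 0 < e & forall y, d (x, y) < e -> U y.

(* The second condition is the continuity of the identity (Z, d) -> Z. *)
Definition dominating_metric d :=
  metric d /\ forall U, open U -> metric_open d U.

Definition admissible_metric d := continuous d /\ dominating_metric d.

Definition dist_to d (A : set Z) (y : Z) : R := inf [set d (y, x) | x in A].

End Metrics.

Definition metrizable (R : realType) (Z : topologicalType) :=
  exists2 d : Z * Z -> R, metric d & forall U, open U <-> metric_open d U.

Definition stratifiable (Y : topologicalType) :=
  accessible_space Y /\
  exists F : set Y -> nat -> set Y,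
    [/\ forall U, open U -> forall n, open (F U n),
        forall U, open U -> forall n, closure (F U n) `<=` U,
        forall U, open U -> \bigcup_n F U n = U &
        forall U V, open U -> open V -> U `<=` V ->
          forall n, F U n `<=` F V n].

Definition upper_semicontinuous (Y X : topologicalType) (u : Y -> set X) :=
  forall U : set X, open U -> open [set y | u y `<=` U].

Section HM_def.
Variables (R : realType) (X : Type).

Definition HMn (n : nat) (f : R -> X) :=
  exists a : nat -> R, [/\ a 0%N = 0, a n = 1,
    forall i, (i < n)%N -> a i < a i.+1 &
    forall i, (i < n)%N -> forall t, a i <= t < a i.+1 -> f t = f (a i)].

(* A function [0, 1) -> X is encoded by its unique extension to R that takes
   the value f 0 outside [0, 1), so that equality in HM is equality of
   functions on [0, 1). *)
Record HM := MkHM {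
  hm_fun :> R -> X;
  hm_step : exists n, HMn n hm_fun;
  hm_out : forall t, ~ (0 <= t < 1) -> hm_fun t = hm_fun 0 }.

Definition hm_supp (f : HM) : set X := [set f t | t in `[0, 1[].

Lemma HMn_cst (x : X) : exists n, HMn n (fun _ : R => x).
Proof.
exists 1%N; exists (fun i => i%:R); split => //.
by move=> i _; rewrite ltr_nat.
Qed.

Definition hm_cst (x : X) : HM := MkHM (HMn_cst x) (fun _ _ => erefl).

HB.instance Definition _ := gen_eqMixin HM.
HB.instance Definition _ := gen_choiceMixin HM.

End HM_def.

Section HM_topology.
Variables (R : realType) (X : topologicalType).
Local Notation HM := (HM R X).
Local Notation mu := (@lebesgue_measure R).

Definition hm_bad (a b : R) (V : set X) (g : HM) : set R :=
  [set t | a <= t < b /\ ~ V (g t)].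

Definition hm_N (a b : R) (V : set X) (e : R) : set HM :=
  [set g | (mu (hm_bad a b V g) < e%:E)%E].

Lemma step_cover (n : nat) (a : nat -> R) (t : R) :
  a 0%N <= t < a n -> exists2 i, (i < n)%N & a i <= t < a i.+1.
Proof.
elim: n => [|n IHn] /andP[a0 an]; first by move: (le_lt_trans a0 an); rewrite ltxx.
have [tn|nt] := ltP t (a n).
  by have [|i lin hi] := IHn; [rewrite a0 | exists i => //; exact: ltnW].
by exists n => //; rewrite nt.
Qed.

Lemma hm_bad_measurable a b V (g : HM) :
  0 <= a -> b <= 1 -> measurable (hm_bad a b V g).
Proof.
move=> a0 b1; have [n [s [s0 s1 sS sC]]] := hm_step g.
have -> : hm_bad a b V g = \bigcup_(i in `I_n)
    (if `[< V (g (s i)) >] then set0 else `[a, b[ `&` `[s i, s i.+1[).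
  apply/seteqP; split => [t [tab nV]|t [i /= iln]].
    have [i iln hi] : exists2 i, (i < n)%N & s i <= t < s i.+1.
      apply: step_cover; rewrite s0 s1; move: tab => /andP[at_ tb].
      by rewrite (le_trans a0 at_) (lt_le_trans tb b1).
    exists i => //; rewrite -(sC i iln t hi).
    by case: asboolP => // _; split; rewrite /= in_itv.
  case: asboolP => // nV []; rewrite /= !in_itv /= => tab ti.
  by split => //; rewrite (sC i iln t ti).
apply: bigcup_measurable => i _; case: ifP => // _.
by apply: measurableI; exact: measurable_itv.
Qed.

Definition hm_subbase (f : HM) : set (set HM) :=
  [set B | exists a b V e, [/\ 0 <= a /\ a < b <= 1,
    forall t, a <= t < b -> f t = f a, nbhs (f a) V, 0 < e &
    B = hm_N a b V e]].

Definition hm_nbhs (f : HM) : set (set HM) :=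
  filter_from (finI_from (hm_subbase f) id) id.

HB.instance Definition _ := hasNbhs.Build HM hm_nbhs.

Lemma hm_nbhs_filter (f : HM) : ProperFilter (nbhs f).
Proof.
apply: (@finI_filter _ _ (hm_subbase f) id) => D DS; exists f => B /= /DS.
rewrite inE => -[a [b [V [e [_ cf fV e0 ->]]]]]; rewrite /hm_N /=.
suff -> : hm_bad a b V f = set0 by rewrite measure0 lte_fin.
apply/seteqP; split => // t [tab]; rewrite cf //; apply.
exact: nbhs_singleton.
Qed.

Lemma hm_nbhs_singleton (f : HM) (A : set HM) : nbhs f A -> A f.
Proof.
case=> _ [D DS <-]; apply => B /= /DS.
rewrite inE => -[a [b [V [e [_ cf fV e0 ->]]]]]; rewrite /hm_N /=.
suff -> : hm_bad a b V f = set0 by rewrite measure0 lte_fin.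
apply/seteqP; split => // t [tab]; rewrite cf //; apply.
exact: nbhs_singleton.
Qed.

Lemma hm_nbhs_N (f : HM) a b V e : 0 <= a -> a < b -> b <= 1 ->
  (forall t, a <= t < b -> f t = f a) -> nbhs (f a) V -> 0 < e ->
  nbhs f (hm_N a b V e).
Proof.
move=> a0 ab b1 cf fV e0; exists (hm_N a b V e) => //.
apply: (@finI_from1 _ _ (hm_subbase f) id).
by exists a, b, V, e; rewrite ab b1.
Qed.

Lemma hm_N_nbhs (g : HM) a b V e : 0 <= a -> b <= 1 ->
  hm_N a b (interior V) e g -> nbhs g (hm_N a b V e).
Proof.
move=> a0 b1; rewrite /hm_N /= => ge.
have [n [s [s0 s1 sS sC]]] := hm_step g.
have sge0 i : (i <= n)%N -> 0 <= s i.
  elim: i => [|i IHi] iln; first by rewrite s0.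
  by rewrite (le_trans (IHi (ltnW iln)))// ltW// sS.
have sle1 i : (i <= n)%N -> s i <= 1.
  rewrite -s1 => iln.
  suff: forall j, (i + j <= n)%N -> s i <= s (i + j)%N.
    by move=> /(_ (n - i)%N); rewrite subnKC//; apply.
  elim=> [|j IHj]; first by rewrite addn0.
  rewrite addnS => ijn; apply: (le_trans (IHj (ltnW ijn))).
  by rewrite ltW// sS.
pose m := mu (hm_bad a b (interior V) g).
have m_fin : m \is a fin_num.
  by rewrite ge0_fin_numE ?measure_ge0// (lt_trans ge) ?ltry.
have me : fine m < e by rewrite -lte_fin fineK.
pose de := (e - fine m) / n.+1%:R.
have de0 : 0 < de by rewrite divr_gt0 ?subr_gt0 ?ltr0n.
pose lo i := Num.max (s i) a; pose hi i := Num.min (s i.+1) b.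
pose C (k : HM) i := if `[< (interior V) (g (s i)) /\ lo i < hi i >]
  then hm_bad (lo i) (hi i) (interior V) k else set0.
have lo0 i : (i < n)%N -> 0 <= lo i by move=> _; rewrite le_max a0 orbT.
have hi1 i : (i < n)%N -> hi i <= 1 by move=> _; rewrite ge_min b1 orbT.
have mC k i : (i < n)%N -> measurable (C k i).
  by move=> iln; rewrite /C; case: ifP => // _; apply: hm_bad_measurable; auto.
have : \forall k \near nbhs g, forall i : 'I_n, (mu (C k i) <= de%:E)%E.
  apply: (@filter_forall _ _ _ _ (hm_nbhs_filter g)) => i.
  rewrite /C; case: asboolP => [[Vg lohi]|_]; last first.
    apply: (@filterS _ _ (hm_nbhs_filter g) setT).
      by move=> k _; rewrite measure0 lee_fin ltW.
    exact: (@filterT _ _ (hm_nbhs_filter g)).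
  have iln := ltn_ord i.
  have gs t : lo i <= t < hi i -> g t = g (s i).
    rewrite /lo /hi ge_max lt_min => /andP[/andP[h1 _] /andP[h2 _]].
    by apply: sC => //; rewrite h1 h2.
  apply: (@filterS _ _ (hm_nbhs_filter g) (hm_N (lo i) (hi i) (interior V) de)).
    by move=> k; rewrite /hm_N /= => /ltW.
  apply: hm_nbhs_N => //; [exact: lo0|exact: hi1| |].
    by move=> t ti; rewrite !gs ?lexx ?lohi.
  rewrite gs ?lexx ?lohi//; apply: open_nbhs_nbhs; split => //.
  exact: open_interior.
apply: (@filterS _ _ (hm_nbhs_filter g)) => k Ck.
have sub : hm_bad a b V k `<=`
    hm_bad a b (interior V) g `|` \big[setU/set0]_(i < n) C k i.
  move=> t [tab nV]; have [i iln ti] : exists2 i, (i < n)%N & s i <= t < s i.+1.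
    apply: step_cover; rewrite s0 s1; move: tab => /andP[at_ tb].
    by rewrite (le_trans a0 at_) (lt_le_trans tb b1).
  have [Vg|nVg] := pselect ((interior V) (g t)); last by left.
  right; rewrite -bigcup_mkord; exists i => //.
  rewrite /C; case: asboolP => [_|].
    split; last by move=> /interior_subset.
    move: ti tab => /andP[? ?] /andP[? ?].
    by rewrite /lo /hi ge_max lt_min; apply/andP; split; apply/andP.
  case; rewrite -(sC i iln t ti); split => //.
  move: ti tab => /andP[? ?] /andP[? ?].
  by apply: (@le_lt_trans _ _ t); rewrite ?ge_max ?lt_min; apply/andP.
have mU : measurable (\big[setU/set0]_(i < n) C k i).
  by apply: bigsetU_measurable => i _; exact: mC.
have mg := hm_bad_measurable (interior V) g a0 b1.
apply: (@le_lt_trans _ _ (m + (\sum_(i < n) de)%:E)%E); last first.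
  rewrite -(fineK m_fin) -EFinD lte_fin sumr_const card_ord -ltrBrDl.
  rewrite -[de *+ n]mulr_natr /de -mulrA gtr_pMr ?subr_gt0//.
  by rewrite mulrC ltr_pdivrMr ?ltr0n// mul1r ltr_nat.
apply: (@le_trans _ _ (mu (hm_bad a b (interior V) g `|` \big[setU/set0]_(i < n) C k i))).
  apply: le_measure; rewrite ?inE //; first exact: hm_bad_measurable.
  exact: measurableU.
apply: le_trans; first exact: measureU2.
rewrite leeD2l//.
apply: (@le_trans _ _ (\sum_(i < n) mu (C k i))%E).
  by apply: Boole_inequality => i iln; exact: mC.
by rewrite -sumEFin; apply: lee_sum => i _; exact: Ck.
Qed.

Lemma hm_nbhs_nbhs (f : HM) (A : set HM) : nbhs f A -> nbhs f (nbhs^~ A).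
Proof.
case=> _ [D DS <-] DA; have Ff := hm_nbhs_filter f.
have : \forall g \near nbhs f, forall B, B \in D -> nbhs g B.
  have := @filter_bigI _ _ D (fun B => [set g : HM | nbhs g B]) (nbhs f) Ff.
  move=> H; apply: filterS (H _) => [g Dg B BD|B BD]; first exact: Dg.
  have := DS _ BD; rewrite inE => -[a [b [V [e [[a0 /andP[ab b1]] cf fV e0 ->]]]]].
  apply: (@filterS _ _ Ff (hm_N a b (interior V) e)) => [g|]; first exact: hm_N_nbhs.
  by apply: hm_nbhs_N => //; exact: nbhs_interior.
apply: (@filterS _ _ Ff) => g Dg; have Fg := hm_nbhs_filter g.
apply: (@filterS _ _ Fg _ _ DA).
by apply: (@filter_bigI _ _ D id (nbhs g) Fg).
Qed.

HB.instance Definition _ := Nbhs_isNbhsTopological.Build HM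
  hm_nbhs_filter hm_nbhs_singleton hm_nbhs_nbhs.

End HM_topology.

Section Operators.
Variables (R : realType) (Y : topologicalType) (X : set Y).
Implicit Types (p : X * X -> R) (T : (X * X -> R) -> (Y * Y -> R)).

Definition extension_operator T :=
  forall p (x x' : X), T p (set_val x, set_val x') = p (x, x').

Definition positive_operator T :=
  forall p, (forall z, 0 <= p z) -> forall z, 0 <= T p z.

Definition continuous_ptws T :=
  continuous (T : {ptws (X * X)%type -> R} -> {ptws (Y * Y)%type -> R}).

Definition continuous_uniform T :=
  continuous (T : {uniform (X * X)%type -> R} -> {uniform (Y * Y)%type -> R}).

Definition continuous_compact_open T :=
  continuous (T : {family (@compact (X * X)%type), (X * X)%type -> R} ->
                  {family (@compact (Y * Y)%type), (Y * Y)%type -> R}).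

Definition preserves_constants T := forall c : R, T (cst c) = cst c.

Definition preserves_bounded T :=
  forall p, bounded_fun (p : _ -> R^o) -> bounded_fun (T p : _ -> R^o).

Definition preserves_continuous T :=
  forall p, continuous p -> continuous (T p).

Definition preserves_pseudometrics T :=
  forall p, pseudometric p -> pseudometric (T p).

Definition preserves_metrics T := forall p, metric p -> metric (T p).

Definition preserves_dominating_metrics T :=
  forall p, dominating_metric p -> dominating_metric (T p).

Definition preserves_admissible_metrics T :=
  forall p, admissible_metric p -> admissible_metric (T p).

Definition dstar (d : Y * Y -> R) : Y * Y -> R := fun z =>
  Num.min (d z) (dist_to d X z.1 + dist_to d X z.2).

Definition opS (h : Y -> HM R X) p : Y * Y -> R := fun z =>
  \int[@lebesgue_measure R]_(t in `[0, 1[) p (h z.1 t, h z.2 t).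

Definition opS1 (a b : X) (d : Y * Y -> R) (h : Y -> HM R X) p : Y * Y -> R :=
  fun z => opS h p z + p (a, b) * dstar d z.

Definition opS2 (a b : X) (d : Y * Y -> R) (h : Y -> HM R X) p : Y * Y -> R :=
  fun z => opS h p z + (p (a, b) - p (a, a)) * dstar d z.

Definition linear_extension_operator T :=
  [/\ linear T, extension_operator T,
      continuous_ptws T, continuous_uniform T & continuous_compact_open T].

Definition extension_data (d : Y * Y -> R) (u : Y -> set X)
    (h : Y -> HM R X) :=
  [/\ [/\ forall y, finite_set (u y), upper_semicontinuous u &
        forall x : X, u (set_val x) = [set x]],
      [/\ continuous h, forall x : X, h (set_val x) = hm_cst R x &
        forall y, hm_supp (h y) `<=` u y] &
      metrizable R Y -> forall y, ~ X y ->
        forall x, u y x -> d (set_val x, y) < 2 * dist_to d X y].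

End Operators.

(* Main.v *)
Require Import Defs.
From mathcomp Require Import all_boot all_order all_algebra.
From mathcomp Require Import finmap all_classical all_reals all_analysis.
From mathcomp Require Import zify ring lra.

Set Implicit Arguments.
Unset Strict Implicit.
Unset Printing Implicit Defensive.

Import Order.TTheory GRing.Theory Num.Theory.
Import numFieldNormedType.Exports.

Local Open Scope classical_set_scope.
Local Open Scope ring_scope.

(** The value [opS h p (y, y')] is an average of [p] over the pairs
    [(h y t, h y' t)], and these pairs take finitely many values, all in the
    finite set [u y `*` u y'].  An average is linear in [p], monotone, and fixes
    constants, which yields the algebraic part of the theorem, the preservation
    of pseudometrics (integrate the triangle inequality) and the extension
    property ([h] is constant on points of [X] while [dstar] vanishes there).

    The three operators have the common form
    [perturbed d h l p = opS h p + l p * dstar X d], with [l p] equal to [0],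
    [p (a, b)] or [p (a, b) - p (a, a)]; each property is proved once for this
    form, under the property of [l] that it requires.

    - Continuity of the operators: the value at [(y, y')] is controlled by the
      values of [p] on [u y `*` u y'] together with finitely many fixed points,
      and as [(y, y')] ranges over a compact set these finite sets stay in a
      compact set, because [u] is upper semicontinuous ([usc_compact]).  This
      gives the three continuities ([controlled_operator_ptws],
      [controlled_operator_uniform], [controlled_operator_compact_open]).

    - Preservation of continuity ([opS_continuous]): when [y] moves slightly,
      [h y] stays close to its old value except on a set of small measure
      ([HM_near_deviation]), and on that exceptional set [p] stays bounded
      because [u y] moves upper semicontinuously.

    - Preservation of metrics: [dstar] is a pseudometric that separates every
      point outside [X] from all other points, and on [X] the operator gives
      back [p].

    - Preservation of dominating metrics ([perturbed_dominating]): near a point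
      outside [X], [dstar] agrees with [d].  Near a point [y] of [X], a small
      value at [(y, y')] forces [dist_to d X y'] to be small and some value
      [h y' t] to be [p]-close, hence [d]-close, to [y]; and [y'] is within
      [2 * dist_to d X y'] of [h y' t].

    - Failure of [opS] to preserve metrics: it cannot separate two points with
      the same image under [h], and [h] can be modified near a single point of
      the complement of [X] so as to stop being injective
      ([exists_noninjective_extension]).

    - The remaining two failures come from [dstar] being positive at some pair
      [(y, b)] with [y] outside [X]. *)

(** * Finite sets and filters *)

Section finite_filters.

Lemma filter_forall_finite (T : choiceType) (I : Type) (F : set_system I)
    (FF : Filter F) (A : set T) (P : T -> I -> Prop) :
  finite_set A -> (forall x, A x -> \forall i \near F, P x i) ->
  \forall i \near F, forall x, A x -> P x i.
Proof.
case/finite_seqP => s ->; elim: s => [_|x s IHs sP]; first exact: nearW.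
have Px : \forall i \near F, P x i by apply: sP; rewrite /= mem_head.
have Ps : \forall i \near F, forall y, y \in s -> P y i.
  by apply: IHs => y ys; apply: sP; rewrite /= inE ys orbT.
apply: filterS2 Px Ps => i Pxi Psi y /=; rewrite inE => /predU1P[->//|].
exact: Psi.
Qed.

Lemma finite_set_bounded (T : choiceType) (R : realType) (A : set T)
    (f : T -> R) :
  finite_set A -> exists M, 0 <= M /\ forall x, A x -> `|f x| <= M.
Proof.
move=> finA.
have fM : \forall M \near +oo, forall x, A x -> `|f x| <= M.
  exact: (filter_forall_finite _ finA (fun x _ => nbhs_pinfty_ge (num_real _))).
have [M [M0 fM']] := filter_ex (filterI (nbhs_pinfty_ge (num_real 0)) fM).
by exists M.
Qed.

End finite_filters.

(** * Functions on [0, 1) with finitely many values *)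

Section step_integrals.
Variable R : realType.
Local Notation mu := (@lebesgue_measure R).
Local Notation I01 := (`[0, 1[%classic : set R).

(** All preimages are required to be measurable, so that composing with an
    arbitrary function on the codomain stays in the class: the kernels [p] of
    the theorem carry no regularity. *)
Definition finite_valued (W : Type) (k : R -> W) :=
  finite_set (k @` I01) /\ forall A, measurable (I01 `&` k @^-1` A).

Lemma finite_valued_comp (W W' : Type) (g : W -> W') (k : R -> W) :
  finite_valued k -> finite_valued (g \o k).
Proof.
move=> [fink mk]; split=> [|A]; last exact: (mk (g @^-1` A)).
by rewrite -image_comp; exact: finite_image.
Qed.

Lemma finite_valued_pair (W W' : choiceType) (k : R -> W) (l : R -> W') :
  finite_valued k -> finite_valued l -> finite_valued (fun t => (k t, l t)).
Proof.
move=> [fink mk] [finl ml]; split.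
  apply: (sub_finite_set _ (finite_setX fink finl)) => _ [t It <-].
  by split; exists t.
move=> A.
have -> : I01 `&` (fun t => (k t, l t)) @^-1` A =
    \bigcup_(w in k @` I01) ((I01 `&` k @^-1` [set w]) `&`
                             (I01 `&` l @^-1` [set w' | A (w, w')])).
  apply/seteqP; split=> [t [It At]|t [w _ [[It /= kt] [_ /= lt]]]].
    by exists (k t) => //; exists t.
  by split => //; rewrite /preimage /= kt.
apply: fin_bigcup_measurable => // w _.
by apply: measurableI; [exact: (mk [set w])|exact: (ml [set w' | A (w, w')])].
Qed.

(** The preimage of [A] is the bad set of [~` A] on the whole of [0, 1). *)
Lemma HM_finite_valued (X : topologicalType) (f : HM R X) : finite_valued f.
Proof.
split=> [|A].
  have [n [s [s0 s1 sS sC]]] := hm_step f.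
  apply: (@sub_finite_set _ _ ((f \o s) @` `I_n)); last exact/finite_image.
  move=> y [t It <-]; move: It; rewrite /= in_itv /= => It.
  have [|i iln hi] := @step_cover R n s t; first by rewrite s0 s1.
  by exists i => //=; rewrite -(sC i iln t hi).
rewrite (_ : _ `&` _ = hm_bad 0 1 (~` A) f); first exact: hm_bad_measurable.
apply/seteqP; split=> t; rewrite /= in_itv /=.
  by move=> [? At]; split => //; rewrite /setC /=; apply.
by move=> [? /contrapT].
Qed.

Lemma lebesgue_measure01 : mu I01 = 1%E.
Proof. by rewrite lebesgue_measure_itv /= lte_fin ltr01 oppr0 adde0. Qed.

Lemma finite_valued_integrable (k : R -> R) :
  finite_valued k -> mu.-integrable I01 (EFin \o k).
Proof.
move=> [fink mk]; apply: measurable_bounded_integrable => //.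
- exact: (eq_ind_r (fun x => x < +oo)%E (ltry 1) lebesgue_measure01).
- by move=> _ B _; exact: mk.
- have [M [_ kM]] := finite_set_bounded id fink.
  exists M; split=> [|N MN t It]; first exact: num_real.
  exact: (le_trans (kM _ (imageP k It)) (ltW MN)).
Qed.

Lemma integral01_cst (c : R) : \int[mu]_(t in I01) c = c.
Proof.
rewrite Rintegral_cst// -[RHS]mulr1; congr *%R.
exact: (congr1 fine lebesgue_measure01).
Qed.

Lemma finite_valued_indic (B : set R) :
  measurable B -> finite_valued (\1_B : R -> R).
Proof.
move=> mB; split=> [|A].
  apply: (@sub_finite_set _ _ [set 0; 1]); last exact: finite_set2.
  by move=> _ [t _ <-]; rewrite indicE; case: (_ \in _) => /=; [right|left].
rewrite preimage_indic; apply: measurableI => //.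
by case: ifP => _; case: ifP => _ //; exact: measurableC.
Qed.

(** The form in which all integrals are estimated: the integrand is at most [e]
    off an exceptional set [B] of small measure and bounded by [e + C] on it. *)
Lemma integral01_norm_le (k : R -> R) (B : set R) (e C : R) :
  finite_valued k -> measurable B -> B `<=` I01 ->
  (forall t, I01 t -> `|k t| <= e + C * \1_B t) ->
  `|\int[mu]_(t in I01) k t| <= e + C * fine (mu B).
Proof.
move=> fk mB BI kB; have iB := finite_valued_indic mB.
apply: (le_trans (le_normr_Rintegral _ (finite_valued_integrable fk))) => //.
apply: (@le_trans _ _ (\int[mu]_(t in I01) (e + C * \1_B t))).
  apply: le_Rintegral => //; apply: finite_valued_integrable.
    exact: (finite_valued_comp Num.norm fk).
  exact: (finite_valued_comp (fun x => e + C * x) iB).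
rewrite RintegralD//; last 2 first.
- exact: (finite_valued_integrable (finite_valued_comp (cst e) iB)).
- exact: (finite_valued_integrable (finite_valued_comp ( *%R C) iB)).
rewrite integral01_cst RintegralZl//; last exact: finite_valued_integrable.
by rewrite /Rintegral integral_indic// setIidl.
Qed.

End step_integrals.

(** * Neighborhoods in the Hartman-Mycielski space *)

Section HM_neighborhoods.
Variables (R : realType) (X : topologicalType).
Local Notation mu := (@lebesgue_measure R).
Local Notation I01 := (`[0, 1[%classic : set R).

Lemma HMn_bounds (n : nat) (s : nat -> R) (i : nat) :
  s 0%N = 0 -> s n = 1 -> (forall j, (j < n)%N -> s j < s j.+1) ->
  (i <= n)%N -> 0 <= s i <= 1.
Proof.
move=> s0 s1 sS; have sle j k : (j + k <= n)%N -> s j <= s (j + k)%N.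
  elim: k => [|k IHk]; first by rewrite addn0.
  by rewrite addnS => jkn; apply: (le_trans (IHk (ltnW jkn))); rewrite ltW// sS.
move=> iln; rewrite -{1}s0 -s1; apply/andP; split; first exact: (sle 0%N i).
by rewrite -(subnKC iln); apply: sle; rewrite subnKC.
Qed.

Definition deviation (V : X -> set X) (f g : HM R X) : set R :=
  I01 `&` [set t | ~ V (f t) (g t)].

Lemma deviation_measurable (V : X -> set X) (f g : HM R X) :
  measurable (deviation V f g).
Proof.
have [_ m] := finite_valued_pair (HM_finite_valued f) (HM_finite_valued g).
exact: (m [set w | ~ V w.1 w.2]).
Qed.

(** A sub-basic neighborhood of [f] tests one interval of constancy against one
    neighborhood.  Imposing such a test on every step of [f], each with its
    share of [e], controls [g] on all of [0, 1) at once, with a neighborhood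
    [V (f t)] varying with [t]. *)
Lemma HM_near_deviation (f : HM R X) (V : X -> set X) (e : R) :
  (forall x, nbhs x (V x)) -> 0 < e ->
  \forall g \near (f : HM R X), (mu (deviation V f g) < e%:E)%E.
Proof.
move=> nV e0; have [n [s [s0 s1 sS sC]]] := hm_step f.
pose de := e / n.+1%:R.
have de0 : 0 < de by rewrite divr_gt0 ?ltr0n.
have bnd (i : 'I_n) : 0 <= s i /\ s i.+1 <= 1.
  have := HMn_bounds s0 s1 sS (ltnW (ltn_ord i)).
  by have := HMn_bounds s0 s1 sS (ltn_ord i) => /andP[_ ->] /andP[->].
have near_i : \forall g \near f, forall i : 'I_n,
    hm_N (s i) (s i.+1) (V (f (s i))) de g.
  apply: (@filter_forall _ _ _ _ (hm_nbhs_filter f)) => i.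
  have [si0 si1] := bnd i.
  by apply: hm_nbhs_N => //; [exact: sS|move=> t; exact: sC].
apply: (filterS _ near_i) => g Ng.
have mbad (i : 'I_n) : measurable (hm_bad (s i) (s i.+1) (V (f (s i))) g).
  by have [si0 si1] := bnd i; exact: hm_bad_measurable.
apply: (@le_lt_trans _ _ (\sum_(i < n) de%:E)%E); last first.
  rewrite sumEFin lte_fin sumr_const card_ord -mulr_natr /de -mulrA gtr_pMr//.
  by rewrite mulrC ltr_pdivrMr ?ltr0n// mul1r ltr_nat.
pose B (i : nat) := hm_bad (s i) (s i.+1) (V (f (s i))) g.
apply: (@le_trans _ _ (\sum_(i < n) mu (B i))%E); last first.
  by apply: lee_sum => i _; exact/ltW/Ng.
apply: (@le_trans _ _ (mu (\big[setU/set0]_(i < n) B i))); last first.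
  by apply: Boole_inequality => i iln; exact: (mbad (Ordinal iln)).
apply: le_measure; rewrite ?inE.
- exact: deviation_measurable.
- by apply: bigsetU_measurable => i _; exact: mbad.
- move=> t [+ nVt]; rewrite /= in_itv /= => It.
  have [|i iln hi] := @step_cover R n s t; first by rewrite s0 s1.
  rewrite -bigcup_mkord; exists i => //; split => //.
  by rewrite -(sC i iln t hi).
Qed.

Lemma cvg_HM (T : Type) (F : set_system T) (FF : Filter F) (k : T -> HM R X)
    (f : HM R X) :
  (forall a b V e, 0 <= a -> a < b -> b <= 1 ->
     (forall t, a <= t < b -> f t = f a) -> nbhs (f a) V -> 0 < e ->
     \forall x \near F, hm_N a b V e (k x)) ->
  k @ F --> f.
Proof.
move=> kF A [_ [D DS <-] DA].
have : \forall x \near F, forall B, B \in D -> B (k x).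
  have H := @filter_bigI _ _ D (fun B => [set x | B (k x)]) F FF.
  apply: filterS (H _) => [x Dx B BD|B BD]; first exact: Dx.
  have := DS _ BD; rewrite inE => -[a [b [V [e [[a0 /andP[ab b1]] cf fV e0 ->]]]]].
  exact: kF.
by apply: filterS => x Dx; apply: DA => B BD; exact: Dx.
Qed.

Lemma HM_ext (f g : HM R X) : (forall t, f t = g t) -> f = g.
Proof.
case: f g => f sf of_ [g sg og] /= /funext fg; subst g.
by congr MkHM; exact: Prop_irrelevance.
Qed.

End HM_neighborhoods.

(** * Overwriting a step function on an initial segment *)

Section glue.
Variables (R : realType) (X : topologicalType).
Local Notation mu := (@lebesgue_measure R).
Local Notation I01 := (`[0, 1[%classic : set R).

(** Constantly [x] on [0, s) and [f] on [s, 1).  The variable is first moved to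
    [0] when it lies outside [0, 1), which is the convention of [HM]. *)
Definition glue_fun (x : X) (s : R) (f : HM R X) (t : R) : X :=
  let t' := if 0 <= t < 1 then t else 0 in if t' < s then x else f t'.

Lemma glue_step x s f : exists n, HMn n (glue_fun x s f).
Proof.
have [s0|s0] := leP s 0.
  have [n [c [c0 c1 cS cC]]] := hm_step f; exists n, c; split => //.
  move=> i iln t /andP[it ti].
  have /andP[ci0 _] := HMn_bounds c0 c1 cS (ltnW iln).
  have /andP[_ ci1] := HMn_bounds c0 c1 cS iln.
  have t0 := le_trans ci0 it.
  rewrite /glue_fun t0 (lt_le_trans ti ci1) ci0 (lt_le_trans (cS i iln) ci1) /=.
  rewrite !ltNge (le_trans s0 t0) (le_trans s0 ci0) /=.
  by apply: cC => //; rewrite it ti.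
have [s1|s1] := leP 1 s.
  exists 1%N, (fun i => i%:R); split => // [i|]; first by rewrite ltr_nat.
  case=> //= _ t /andP[t0 t1]; rewrite /glue_fun t0 t1 lexx ltr01 /=.
  by rewrite (lt_le_trans t1 s1) (lt_le_trans ltr01 s1).
have [n [c [c0 c1 cS cC]]] := hm_step f.
have [|i iln /andP[is_ si]] := @step_cover R n c s.
  by rewrite c0 c1 (ltW s0) s1.
(* The steps are [0, s) and then those of [f] cut at [s], which lies in the
   step number [i]. *)
pose c' j := if j is j'.+1 then if j' is j''.+1 then c (i.+1 + j'')%N else s else 0.
have cb j : (j <= n)%N -> 0 <= c j <= 1 := HMn_bounds c0 c1 cS.
exists (n - i).+1, c'; split=> //.
- by rewrite -(subnSK iln) /c' subnKC.
- move=> [|[|j]] jn /=; first exact: s0.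
    by rewrite addn0.
  by rewrite addnS; apply: cS; lia.
- move=> [|[|j]] jn t /= /andP[ct tc].
  + by rewrite /glue_fun ct (lt_trans tc s1) lexx ltr01 /= tc s0.
  + move: tc; rewrite addn0 => tc.
    have /andP[_ ci1] := cb i.+1 iln.
    rewrite /glue_fun (le_trans (ltW s0) ct) (lt_le_trans tc ci1) (ltW s0) s1 /=.
    rewrite ltxx ltNge ct /= (cC i)//; last by rewrite (le_trans is_ ct).
    by rewrite (cC i iln s)// is_ si.
  + have jn' : (i.+1 + j < n)%N by lia.
    rewrite addnS in tc.
    have /andP[cj0 _] := cb _ (ltnW jn'); have /andP[_ cj1] := cb _ jn'.
    have sc : s <= c (i.+1 + j)%N.
      apply: (le_trans (ltW si)).
      elim: j {jn ct tc cj0 cj1} jn' => [|j IHj] jn'; first by rewrite addn0.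
      rewrite addnS; apply: (le_trans (IHj _)); last by rewrite ltW// cS//; lia.
      by lia.
    rewrite /glue_fun (le_trans cj0 ct) (lt_le_trans tc cj1) cj0 /=.
    rewrite (lt_le_trans (cS _ jn') cj1) !ltNge sc (le_trans sc ct) /=.
    by apply: cC => //; rewrite ct tc.
Qed.

Lemma glue_out x s f t : ~ (0 <= t < 1) -> glue_fun x s f t = glue_fun x s f 0.
Proof. by rewrite /glue_fun lexx ltr01 => /negP/negbTE ->. Qed.

Definition glue x s f : HM R X := MkHM (glue_step x s f) (@glue_out x s f).

Lemma glueE x s f t : 0 <= t < 1 -> glue x s f t = if t < s then x else f t.
Proof. by move=> It; rewrite /= /glue_fun It. Qed.

Lemma glue_le0 x s f : s <= 0 -> glue x s f = f.
Proof.
move=> s0; apply: HM_ext => t; have [It|It] := boolP (0 <= t < 1).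
  by rewrite glueE// ltNge (le_trans s0)//; case/andP: It.
rewrite !hm_out; [|exact/negP..].
by rewrite glueE ?lexx ?ltr01// ltNge s0.
Qed.

Lemma glue_ge1 x s f : 1 <= s -> glue x s f = hm_cst R x.
Proof.
move=> s1; apply: HM_ext => t /=; rewrite /glue_fun.
case: ifP => // /negP[]; case: ifP => [/andP[_ t1]|_].
  exact: lt_le_trans t1 s1.
exact: lt_le_trans ltr01 s1.
Qed.

Lemma hm_supp_glue x s f : hm_supp (glue x s f) `<=` x |` hm_supp f.
Proof.
move=> _ [t It <-]; rewrite glueE; last by move: It; rewrite /= in_itv.
by case: ifP => _; [left|right; exists t].
Qed.

(** Moving [s] changes the glued function only between the two cut points, so on
    a set of measure at most the displacement of [s]; elsewhere the deviation is
    that of [h]. *)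
Lemma continuous_glue (T : topologicalType) (x : X) (phi : T -> R)
    (h : T -> HM R X) :
  continuous phi -> continuous h -> continuous (fun y => glue x (phi y) (h y)).
Proof.
move=> cphi ch y; apply: cvg_HM => a b V e a0 ab b1 cst_ab nV e0.
(* [V] is only a neighborhood of the values taken on [a, b), so it is replaced
   by the whole space elsewhere to apply [HM_near_deviation]. *)
pose W (w : X) := if `[< nbhs w V >] then V else setT.
have nW w : nbhs w (W w).
  by rewrite /W; case: asboolP => // _; exact: filterT.
have e20 : 0 < e / 2 by rewrite divr_gt0.
have dev : \forall z \near y, (mu (deviation W (h y) (h z)) < (e / 2)%:E)%E.
  exact: (ch y _ (HM_near_deviation (h y) nW e20)).
have dphi : \forall z \near y, `|phi y - phi z| < e / 2.
  by move/cvgr_dist_lt : (cphi y); apply.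
apply: filterS2 dev dphi => z dev dphi; rewrite /hm_N /=.
pose lo := Num.min (phi y) (phi z); pose hi := Num.max (phi y) (phi z).
apply: (@le_lt_trans _ _ (mu (deviation W (h y) (h z) `|` `[lo, hi[%classic))).
  apply: le_measure; rewrite ?inE; first exact: hm_bad_measurable.
    by apply: measurableU => //; exact: deviation_measurable.
  move=> t [tab nVt]; have It : 0 <= t < 1.
    by case/andP: tab => at_ tb; rewrite (le_trans a0 at_) (lt_le_trans tb b1).
  have := cst_ab t tab; rewrite glueE// => gt.
  move: nVt; rewrite glueE// => nVt.
  have [tlo|lot] := ltP t lo.
    move: tlo nVt gt; rewrite /lo lt_min => /andP[-> ->] nVx gt.
    by exfalso; apply: nVx; rewrite gt; exact: nbhs_singleton.
  have [thi|hit] := ltP t hi; first by right; rewrite /= in_itv /= lot thi.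
  left; split; first by rewrite /= in_itv.
  move: hit nVt gt; rewrite /hi ge_max => /andP[ht1 ht2].
  rewrite ltNge ht2 /= ltNge ht1 /= => nVt gt.
  rewrite /W gt; case: asboolP => //.
have measI : (mu (`[lo, hi[%classic : set R) <= (e / 2)%:E)%E.
  rewrite lebesgue_measure_itv /= lte_fin.
  case: ifP => [_|_]; last by rewrite lee_fin ltW.
  rewrite -EFinB lee_fin ltW// (le_lt_trans _ dphi)// /lo /hi.
  have [yz|zy] := leP (phi y) (phi z).
    by rewrite distrC ger0_norm ?subr_ge0.
  by rewrite ger0_norm// subr_ge0 ltW.
apply: (le_lt_trans (measureU2 _ _ _)) => //; first exact: deviation_measurable.
rewrite [e]splitr EFinD.
apply: le_lt_trans (leeD2l _ measI) _.
by apply: lte_leD.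
Qed.

End glue.

(** * Continuity of operators controlled by few values *)

Section controlled_operators.
Variables (R : realType) (Z Z' : topologicalType) (T : (Z -> R) -> (Z' -> R)).
Variables (C : R) (W : Z' -> set Z).

(** The value of [T p] at [z] depends only on [p] on the carrier [W z], in a
    Lipschitz manner with a constant independent of [z]. *)
Definition controlled_operator := forall p q z e,
  (forall w, W z w -> `|p w - q w| <= e) -> `|T p z - T q z| <= C * e.

Hypotheses (C0 : 0 < C) (lipT : controlled_operator).

(** All continuity statements in uniform topologies reduce to this one: uniform
    convergence on a set containing the carriers of the points of [B] gives
    uniform convergence on [B]. *)
Lemma cvg_uniform_on (F : set_system (Z -> R)) (FF : Filter F) (p : Z -> R)
    (A : set Z) (B : set Z') :
  (forall z, B z -> W z `<=` A) ->
  {uniform A, F --> p} -> {uniform B, T @ F --> T p}.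
Proof.
move=> BA Fp P /uniform_nbhs [E [+ EP]].
rewrite -entourage_ballE => -[e /= e0 ballE].
have Ce0 : 0 < e / 2 / C by rewrite !divr_gt0.
have Ap : \forall q \near F, forall w, A w -> `|p w - q w| < e / 2 / C.
  apply: Fp; apply/uniform_nbhs.
  exists [set xy | `|xy.1 - xy.2| < e / 2 / C].
  split; last by move=> q pq w Aw; exact: (pq w Aw).
    by rewrite -entourage_ballE; exists (e / 2 / C).
apply: filterS Ap => q Apq; apply: EP => z Bz; apply: ballE => /=.
rewrite /ball /= (@le_lt_trans _ _ (C * (e / 2 / C)))//.
  by apply: lipT => w Ww; exact/ltW/Apq/(BA z Bz).
by rewrite mulrC divfK ?gt_eqF// ltr_pdivrMr// ltr_pMr// ltr1n.
Qed.

Lemma controlled_operator_uniform :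
  continuous (T : {uniform Z -> R} -> {uniform Z' -> R}).
Proof.
move=> p; apply: (@cvg_uniform_on _ _ p setT setT) => //.
exact: (@nbhs_filter {uniform Z -> R} p).
Qed.

Lemma controlled_operator_compact_open :
  (forall K, compact K -> exists2 A, compact A & forall z, K z -> W z `<=` A) ->
  continuous (T : {family (@compact Z), Z -> R} ->
                  {family (@compact Z'), Z' -> R}).
Proof.
move=> cptW p.
pose F : set_system (Z -> R) := nbhs (p : {family (@compact Z), Z -> R}).
have FF : Filter F := @nbhs_filter {family (@compact Z), Z -> R} p.
have Fp := (@fam_cvgP Z R (@compact Z) F p FF).1 (fun _ h => h).
apply: (@fam_cvgP Z' R (@compact Z') (T @ F) (T p) _).2 => K /cptW[A cA KA].
exact: (cvg_uniform_on FF KA (Fp A cA)).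
Qed.

Lemma controlled_operator_ptws :
  (forall z, finite_set (W z)) ->
  continuous (T : {ptws Z -> R} -> {ptws Z' -> R}).
Proof.
move=> finW p.
pose F : set_system (Z -> R) := nbhs (p : {ptws Z -> R}).
have FF : Filter F := @nbhs_filter {ptws Z -> R} p.
have Fp := (@pointwise_cvgP Z R F p FF).1 (fun _ h => h).
apply: (@pointwise_cvgP Z' R (T @ F) (T p) _).2 => z.
apply/cvgrPdist_lt => e e0.
have Ce0 : 0 < e / 2 / C by rewrite !divr_gt0.
have Wp : \forall q \near F, forall w, W z w -> `|p w - q w| < e / 2 / C.
  apply: (filter_forall_finite FF (finW z)) => w _.
  by have /cvgrPdist_lt := Fp w; apply.
have Tp : \forall q \near F, `|T p z - T q z| < e.
  apply: filterS Wp => q Wpq; rewrite (@le_lt_trans _ _ (C * (e / 2 / C)))//.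
    by apply: lipT => w Ww; exact/ltW/Wpq.
  by rewrite mulrC divfK ?gt_eqF// ltr_pdivrMr// ltr_pMr// ltr1n.
exact: Tp.
Qed.

End controlled_operators.

(** * Finite-valued upper semicontinuous maps *)

Section finite_usc.
Variables (X Y : topologicalType) (u : Y -> set X).
Hypotheses (finu : forall y, finite_set (u y)) (uscu : upper_semicontinuous u).

(** The union of the interiors of the [V x] is an open set containing [u y]. *)
Lemma usc_near (y : Y) (V : X -> set X) :
  (forall x, u y x -> nbhs x (V x)) ->
  \forall z \near y, forall x', u z x' -> exists2 x, u y x & V x x'.
Proof.
move=> nV; pose U := \bigcup_(x in u y) interior (V x).
have oU : open U by apply: bigcup_open => x _; exact: open_interior.
have : nbhs y [set z | u z `<=` U].
  apply: open_nbhs_nbhs; split; first exact: uscu.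
  by move=> x uyx; exists x => //; exact: nV.
apply: filterS => z uzU x' /uzU [x uyx /interior_subset Vx]; exists x => //.
Qed.

(** A property known near each point of the image holds, by finiteness of [u y]
    and upper semicontinuity, on [u z] for all [z] near [y]; compactness of [K]
    then applies to the property [u z `<=` P i] of [z]. *)
Lemma usc_compact (K : set Y) : compact K -> compact (\bigcup_(y in K) u y).
Proof.
move=> /compact_near_coveringP cK; apply/compact_near_coveringP => I F P FF covP.
have covQ : forall y, K y -> \forall y' \near y & i \near F, u y' `<=` P i.
  move=> y Ky.
  have : forall x, exists VA : set X * set I, u y x ->
      [/\ nbhs x VA.1, F VA.2 & forall x' i, VA.1 x' -> VA.2 i -> P i x'].
    move=> x; have [uyx|nuyx] := pselect (u y x); last by exists (set0, set0).
    have [[V A] [/= xV FA] VAP] := covP x (ex_intro2 _ _ y Ky uyx).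
    by exists (V, A) => _; split => // x' i Vx' Ai; exact: (VAP (x', i)).
  move=> /choice[VA VAP].
  exists ([set z | forall x', u z x' -> exists2 x, u y x & (VA x).1 x'],
          [set i | forall x, u y x -> (VA x).2 i]) => /=.
    split; first by apply: usc_near => x /VAP[].
    by apply: filter_forall_finite => // x /VAP[].
  move=> [z i] /= [Hz Hi] x' /Hz [x uyx Vx'].
  by have [_ _] := VAP x uyx; apply => //; exact: Hi.
have := cK I F _ FF covQ.
by apply: filterS => i KP x [y Ky]; exact: KP.
Qed.

End finite_usc.

(** * The distance to a subset and the pseudometric dstar *)

Section distance_to_set.
Variables (R : realType) (Y : topologicalType) (X : set Y) (d : Y * Y -> R).
Hypotheses (X0 : X !=set0) (dY : pseudometric d).

Let d_ge0 x y : 0 <= d (x, y). Proof. by case: dY. Qed.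
Let d_refl x : d (x, x) = 0. Proof. by case: dY. Qed.
Let d_sym x y : d (x, y) = d (y, x). Proof. by case: dY. Qed.
Let d_tri x y z : d (x, z) <= d (x, y) + d (y, z). Proof. by case: dY. Qed.

Local Notation delta := (dist_to d X).

Lemma dist_to_le y x : X x -> delta y <= d (y, x).
Proof.
move=> Xx; apply: ge_inf; last by exists x.
by exists 0 => _ [z _ <-].
Qed.

Lemma dist_to_ge0 y : 0 <= delta y.
Proof.
by apply: lb_le_inf => [|_ [z _ <-] //]; exact: image_nonempty.
Qed.

Lemma dist_to_in y : X y -> delta y = 0.
Proof.
move=> Xy; apply/eqP; rewrite eq_le dist_to_ge0 andbT.
by rewrite -(d_refl y) dist_to_le.
Qed.

Lemma dist_to_lipschitz y z : delta y <= d (y, z) + delta z.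
Proof.
rewrite -lerBlDl; apply: lb_le_inf; first exact: image_nonempty.
move=> _ [x Xx <-]; rewrite lerBlDl.
exact: (le_trans (dist_to_le y Xx) (d_tri _ _ _)).
Qed.

Lemma dstar_pseudometric : pseudometric (dstar X d).
Proof.
rewrite /dstar; split=> [x y|x|x y|x y z] /=.
- by rewrite le_min d_ge0 addr_ge0 ?dist_to_ge0.
- by rewrite d_refl; apply/min_idPl; rewrite addr_ge0 ?dist_to_ge0.
- by rewrite d_sym addrC.
- have := d_tri x y z; have := dist_to_lipschitz x y.
  have := dist_to_lipschitz z y; rewrite (d_sym z y).
  have := dist_to_ge0 x; have := dist_to_ge0 y; have := dist_to_ge0 z.
  rewrite ge_min; move: (d (x, y)) (d (y, z)) (d (x, z)) => xy yz xz.
  move: (delta x) (delta y) (delta z) => x' y' z'.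
  by case: (leP xy); case: (leP yz) => *; apply/orP;
    do ?[by left; lra]; right; lra.
Qed.

Lemma dstar_restrict x x' : X x -> X x' -> dstar X d (x, x') = 0.
Proof.
move=> Xx Xx'; rewrite /dstar /= !dist_to_in// addr0.
exact/min_idPr.
Qed.

Lemma dstar_to_set x y : X x -> dstar X d (x, y) = delta y.
Proof.
move=> Xx; rewrite /dstar /= (dist_to_in Xx) add0r; apply/min_idPr.
by rewrite d_sym dist_to_le.
Qed.

(** The other term of the minimum is at least [delta y], so outside [X] small
    balls of [dstar] are balls of [d]. *)
Lemma dstar_lt_dist y z : dstar X d (y, z) < delta y -> dstar X d (y, z) = d (y, z).
Proof.
rewrite /dstar /= minEle; case: ifP => // _.
by rewrite gtrDl ltNge dist_to_ge0.
Qed.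

Hypothesis dc : continuous d.

Lemma near_dist_lt y e : 0 < e -> \forall z \near y, d (y, z) < e.
Proof.
move=> e0; have /cvgrPdist_lt dcy : d z @[z --> (y, y)] --> d (y, y) by exact: dc.
have [[A B] [/= yA yB] AB] := dcy e e0.
apply: filterS yB => z Bz; have := AB (y, z) (conj (nbhs_singleton yA) Bz).
by rewrite /= d_refl sub0r normrN ger0_norm.
Qed.

Lemma dist_to_continuous : continuous delta.
Proof.
move=> y; apply/cvgrPdist_lt => e e0; apply: filterS (near_dist_lt y e0) => z.
apply: le_lt_trans; rewrite ler_norml.
have := dist_to_lipschitz y z; have := dist_to_lipschitz z y; rewrite (d_sym z).
by move=> *; apply/andP; split; lra.
Qed.

Lemma dstar_continuous : continuous (dstar X d).
Proof.
move=> z; apply: (@continuous_min R (Y * Y)%type d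
  (fun z => delta z.1 + delta z.2) z (@dc z)).
apply: cvgD; apply: (@cvg_comp _ _ _ _ _ _ (nbhs _)); try exact: dist_to_continuous.
  exact: cvg_fst.
exact: cvg_snd.
Qed.

Lemma open_dist_ball y r : open [set z | d (y, z) < r].
Proof.
rewrite openE => z /=; rewrite -subr_gt0 => /(near_dist_lt z).
apply: filterS => w; have := d_tri y z w; move=> /= *; lra.
Qed.

End distance_to_set.

(** * The averaging operator *)

Section averaging.
Variables (R : realType) (Y : topologicalType) (X : set Y) (h : Y -> HM R X).
Local Notation mu := (@lebesgue_measure R).
Local Notation I01 := (`[0, 1[%classic : set R).
Implicit Types (p q : X * X -> R) (z : Y * Y).

Lemma opS_integrand_finite_valued p z :
  finite_valued (fun t => p (h z.1 t, h z.2 t)).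
Proof.
apply: (finite_valued_comp p).
exact: (finite_valued_pair (HM_finite_valued _) (HM_finite_valued _)).
Qed.

Lemma opS_integrable p z :
  mu.-integrable I01 (EFin \o (fun t => p (h z.1 t, h z.2 t))).
Proof. exact/finite_valued_integrable/opS_integrand_finite_valued. Qed.

Lemma opS_linear c p q z : opS h (c *: p + q) z = c * opS h p z + opS h q z.
Proof.
rewrite /opS -RintegralZl//; last exact: opS_integrable.
rewrite -RintegralD//; last exact: opS_integrable.
exact: (opS_integrable (fun w => c * p w)).
Qed.

Lemma opS_le p q z z' :
  (forall t, 0 <= t < 1 -> p (h z.1 t, h z.2 t) <= q (h z'.1 t, h z'.2 t)) ->
  opS h p z <= opS h q z'.
Proof.
move=> pq; apply: le_Rintegral => //; exact: opS_integrable.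
Qed.

Lemma opS_cst c z : opS h (cst c) z = c.
Proof. exact: integral01_cst. Qed.

Lemma opS_ge0 p z : (forall w, 0 <= p w) -> 0 <= opS h p z.
Proof. by move=> p0; apply: Rintegral_ge0. Qed.

Lemma opS_ge p e z :
  (forall t, 0 <= t < 1 -> e <= p (h z.1 t, h z.2 t)) -> e <= opS h p z.
Proof.
by move=> pe; rewrite -(opS_cst e z); exact: opS_le.
Qed.

Lemma opS_norm_le p e z :
  (forall t, 0 <= t < 1 -> `|p (h z.1 t, h z.2 t)| <= e) -> `|opS h p z| <= e.
Proof.
move=> pe; have := @integral01_norm_le R (fun t => p (h z.1 t, h z.2 t)) set0 e 0.
rewrite mul0r addr0; apply => //; first exact: opS_integrand_finite_valued.
by move=> t It; rewrite mul0r addr0; apply: pe; move: It; rewrite /= in_itv.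
Qed.

Lemma opSB p q z : opS h (p - q) z = opS h p z - opS h q z.
Proof.
have := opS_linear (-1) q p z.
by rewrite scaleN1r addrC mulN1r [- _ + _]addrC.
Qed.

Lemma opS_extension (hX : forall x : X, h (set_val x) = hm_cst R x) p (x x' : X) :
  opS h p (set_val x, set_val x') = p (x, x').
Proof. by rewrite /opS /= !hX /= integral01_cst. Qed.

(** Only the triangle inequality needs an argument: the three points must be
    followed along the same parameter [t]. *)
Lemma opS_pseudometric p : pseudometric p -> pseudometric (opS h p).
Proof.
move=> [p0 p1 ps pt]; split=> [x y|x|x y|x y z].
- by apply: opS_ge0 => -[].
- rewrite -[RHS](opS_cst 0 (x, x)); apply: eq_Rintegral => t _.
  exact: p1.
- by apply: eq_Rintegral => t _; exact: ps.
- have -> : opS h p (x, y) + opS h p (y, z) =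
      \int[mu]_(t in I01) (p (h x t, h y t) + p (h y t, h z t)).
    rewrite RintegralD//; first exact: (opS_integrable p (x, y)).
    exact: (opS_integrable p (y, z)).
  apply: le_Rintegral => //; first exact: opS_integrable.
  apply: finite_valued_integrable.
  have fxyz := finite_valued_pair
    (finite_valued_pair (HM_finite_valued (h x)) (HM_finite_valued (h y)))
    (HM_finite_valued (h z)).
  exact: (finite_valued_comp (fun w => p w.1 + p (w.1.2, w.2)) fxyz).
Qed.

Variable u : Y -> set X.
Hypotheses (finu : forall y, finite_set (u y)) (uscu : upper_semicontinuous u).
Hypotheses (ch : continuous h) (hu : forall y, hm_supp (h y) `<=` u y).

Lemma hm_in_u y t : 0 <= t < 1 -> u y (h y t).
Proof. by move=> It; apply: hu; exists t => //; rewrite /= in_itv. Qed.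

Lemma opS_local p q z e :
  (forall w, (u z.1 `*` u z.2) w -> `|p w - q w| <= e) ->
  `|opS h p z - opS h q z| <= e.
Proof.
move=> pq; rewrite -opSB; apply: opS_norm_le => t It.
by apply: pq; split; exact: hm_in_u.
Qed.

(** Around each pair in the finite set [u y `*` u y'] fix a box on which [p]
    varies by less than [e / 3].  For [(z, z')] near [(y, y')], the pairs
    [(h z t, h z' t)] lie in the box of [(h y t, h y' t)] except for [t] in a
    set of small measure, where they still lie in some box since [u] is upper
    semicontinuous; there [p] is bounded by its maximum on [u y `*` u y'] plus
    [e / 3]. *)
Lemma opS_continuous p : continuous p -> continuous (opS h p).
Proof.
move=> cp [y y']; apply/cvgrPdist_lt => e e0.
have e30 : 0 < e / 3 by rewrite divr_gt0.
have near_p (w : X * X) : exists VV : set X * set X,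
    [/\ nbhs w.1 VV.1, nbhs w.2 VV.2 &
      forall v v', VV.1 v -> VV.2 v' -> `|p w - p (v, v')| < e / 3].
  have /cvgrPdist_lt cpw : p v @[v --> w] --> p w by exact: cp.
  have [VV [/= V1 V2] sVV] := cpw _ e30.
  by exists VV; split => // v v' Vv Vv'; exact: (sVV (v, v')).
have [VV VVP] := choice near_p.
(* The boxes of all pairs with first entry [x] (resp. second entry [x'])
   are shrunk to a common side. *)
pose V x := [set v | forall x', u y' x' -> (VV (x, x')).1 v].
pose V' x' := [set v | forall x, u y x -> (VV (x, x')).2 v].
have nV x : nbhs x (V x).
  by apply: (filter_forall_finite (nbhs_filter x) (finu y')) => x' _;
    have [] := VVP (x, x').
have nV' x' : nbhs x' (V' x').
  by apply: (filter_forall_finite (nbhs_filter x') (finu y)) => x _;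
    have [] := VVP (x, x').
have Vp x x' v v' : u y x -> u y' x' -> V x v -> V' x' v' ->
    `|p (x, x') - p (v, v')| < e / 3.
  move=> ux ux' Vv Vv'; have [_ _] := VVP (x, x'); apply.
    exact: Vv.
  exact: Vv'.
have [M [M0 pM]] := finite_set_bounded p (finite_setX (finu y) (finu y')).
pose C := M + M + e / 3.
have C0 : 0 < C by rewrite /C; lra.
(* With two exceptional sets of measure below [dl], the bound [C] on them
   contributes at most [e / 3]. *)
pose dl := e / 6 / C.
have dl0 : 0 < dl by rewrite !divr_gt0.
pose G (z : Y) := (mu (deviation V (h y) (h z)) < dl%:E)%E /\
  forall v, u z v -> exists2 x, u y x & V x v.
pose G' (z : Y) := (mu (deviation V' (h y') (h z)) < dl%:E)%E /\
  forall v, u z v -> exists2 x, u y' x & V' x v.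
have nG : nbhs y G.
  apply: filterI; first exact: (@ch y _ (HM_near_deviation (h y) nV dl0)).
  exact: usc_near.
have nG' : nbhs y' G'.
  apply: filterI; first exact: (@ch y' _ (HM_near_deviation (h y') nV' dl0)).
  exact: usc_near.
apply: (@filterS _ (nbhs (y, y')) _ (fun z => G z.1 /\ G' z.2)); last first.
  by exists (G, G').
move=> [z z'] /= [[dz uz] [dz' uz']].
pose B := deviation V (h y) (h z) `|` deviation V' (h y') (h z').
have mB : measurable B by apply: measurableU; exact: deviation_measurable.
have muB : fine (mu B) <= dl + dl.
  have muB : (mu B <= (dl + dl)%:E)%E.
    apply: (le_trans (measureU2 _ _ _)); try exact: deviation_measurable.
    by rewrite EFinD; apply: leeD; exact: ltW.
  rewrite -lee_fin fineK// ge0_fin_numE//.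
  exact: (le_lt_trans muB (ltry _)).
rewrite /opS /= -RintegralB//; last 2 first.
- exact: (opS_integrable p (y, y')).
- exact: (opS_integrable p (z, z')).
apply: (@le_lt_trans _ _ (e / 3 + C * fine (mu B))).
  apply: integral01_norm_le => //.
  - have f4 := finite_valued_pair
      (finite_valued_pair (HM_finite_valued (h y)) (HM_finite_valued (h y')))
      (finite_valued_pair (HM_finite_valued (h z)) (HM_finite_valued (h z'))).
    exact: (finite_valued_comp (fun w => p w.1 - p w.2) f4).
  - by move=> t [] [].
  - move=> t It; have It' : 0 <= t < 1 by move: It; rewrite /= in_itv.
    have pyM : `|p (h y t, h y' t)| <= M.
      by apply: pM; split; exact: hm_in_u.
    have [x ux Vx] := uz _ (hm_in_u z It').
    have [x' ux' Vx'] := uz' _ (hm_in_u z' It').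
    have [Bt|nBt] := pselect (B t).
      rewrite indicE mem_set// mulr1.
      have pxM : `|p (x, x')| <= M by apply: pM.
      have := Vp _ _ _ _ ux ux' Vx Vx'.
      move: pyM pxM; rewrite !ler_norml ltr_norml => /andP[? ?] /andP[? ?] /andP[? ?].
      by rewrite /C; apply/andP; split; lra.
    rewrite indicE memNset// mulr0 addr0; apply/ltW/Vp; try exact: hm_in_u.
      by apply: contrapT => nVt; apply: nBt; left.
    by apply: contrapT => nVt; apply: nBt; right.
have : C * fine (mu B) <= C * (dl + dl) by rewrite ler_pM2l.
have -> : C * (dl + dl) = e / 3.
  by rewrite /dl; field; rewrite gt_eqF.
by move=> ?; lra.
Qed.

End averaging.

(** * Averaging perturbed by a multiple of dstar *)

Section perturbed_operators.
Variables (R : realType) (Y : topologicalType) (X : set Y).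
Variables (d : Y * Y -> R) (u : Y -> set X) (h : Y -> HM R X).
Hypotheses (X0 : X !=set0) (dY : pseudometric d) (d1 : forall z, d z <= 1).
Hypotheses (finu : forall y, finite_set (u y)) (uscu : upper_semicontinuous u).
Hypotheses (ch : continuous h) (hX : forall x : X, h (set_val x) = hm_cst R x).
Hypotheses (hu : forall y, hm_supp (h y) `<=` u y).

Variable l : (X * X -> R) -> R.
Implicit Types (p q : X * X -> R).

(** The common form of the three operators, with [l p] standing for [0],
    [p (a, b)] and [p (a, b) - p (a, a)]. *)
Definition perturbed p : Y * Y -> R :=
  fun z => opS h p z + l p * dstar X d z.

Let dstar0 z : 0 <= dstar X d z.
Proof. by case: z => y y'; have [] := dstar_pseudometric X0 dY. Qed.

Let dstar1 z : `|dstar X d z| <= 1.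
Proof. by rewrite ger0_norm// /dstar ge_min d1. Qed.

Section linear_extension.
Variable D : set (X * X).
(** [D] carries the functional [l]; the constant [2] allows for a difference of
    two values of [p]. *)
Hypotheses (finD : finite_set D).
Hypothesis l_linear : forall c p q, l (c *: p + q) = c * l p + l q.
Hypothesis l_local : forall p q e,
  (forall w, D w -> `|p w - q w| <= e) -> `|l p - l q| <= 2 * e.

Let W (z : Y * Y) := (u z.1 `*` u z.2) `|` D.

Lemma perturbed_controlled : controlled_operator perturbed 3 W.
Proof.
move=> p q z e pq; rewrite /perturbed.
have -> : opS h p z + l p * dstar X d z - (opS h q z + l q * dstar X d z) =
  (opS h p z - opS h q z) + (l p - l q) * dstar X d z by ring.
have Sle : `|opS h p z - opS h q z| <= e.
  by apply: (opS_local hu) => w Ww; apply: pq; left.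
have lle : `|(l p - l q) * dstar X d z| <= 2 * e.
  rewrite normrM; apply: (@le_trans _ _ `|l p - l q|).
    by rewrite ler_piMr.
  by apply: l_local => w Dw; apply: pq; right.
by apply: (le_trans (ler_normD _ _)); lra.
Qed.

Lemma perturbed_carrier_compact (K : set (Y * Y)) : compact K ->
  exists2 A, compact A & forall z, K z -> W z `<=` A.
Proof.
move=> cK.
have c1 : compact (fst @` K).
  apply: continuous_compact => //; apply: continuous_subspaceT => z.
  exact: cvg_fst.
have c2 : compact (snd @` K).
  apply: continuous_compact => //; apply: continuous_subspaceT => z.
  exact: cvg_snd.
exists (((\bigcup_(y in fst @` K) u y) `*` (\bigcup_(y in snd @` K) u y)) `|` D).
  apply: compactU; last exact: finite_compact.
  by apply: compact_setX; exact: usc_compact.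
move=> z Kz w [[w1 w2]|Dw]; last by right.
by left; split; [exists z.1 => //; exists z|exists z.2 => //; exists z].
Qed.

Lemma perturbed_linear_extension : linear_extension_operator perturbed.
Proof.
split.
- move=> c p q. apply/funext => z.
  rewrite [RHS](_ : _ = c * perturbed p z + perturbed q z)//.
  by rewrite /perturbed opS_linear l_linear; ring.
- move=> p x x'; rewrite /perturbed dstar_restrict ?mulr0 ?addr0//.
  + exact: opS_extension.
  + exact: set_valP.
  + exact: set_valP.
- apply: (controlled_operator_ptws _ perturbed_controlled) => // z.
  by rewrite finite_setU; split => //; exact: finite_setX.
- exact: (controlled_operator_uniform _ perturbed_controlled).
- apply: (controlled_operator_compact_open _ perturbed_controlled) => //.
  exact: perturbed_carrier_compact.
Qed.

End linear_extension.

Lemma perturbed_bounded : preserves_bounded perturbed.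
Proof.
move=> p [M [_ pM]]; exists (M + 1 + `|l p|); split=> [|N MN z _ /=].
  exact: num_real.
apply: le_trans (ltW MN); apply: (le_trans (ler_normD _ _)); apply: lerD.
  by apply: opS_norm_le => t _; apply: pM => //; rewrite ltrDl.
by rewrite normrM ler_piMr.
Qed.

Lemma perturbed_continuous : continuous d -> preserves_continuous perturbed.
Proof.
move=> dc p cp z; apply: cvgD; first exact: (opS_continuous finu uscu ch hu cp).
by apply: cvgM; [exact: cvg_cst|exact: dstar_continuous].
Qed.

Lemma perturbed_positive :
  (forall p, (forall w, 0 <= p w) -> 0 <= l p) -> positive_operator perturbed.
Proof.
by move=> l0 p p0 z; rewrite addr_ge0 ?mulr_ge0 ?opS_ge0 ?l0.
Qed.

Lemma perturbed_constants :
  (forall c, l (cst c) = 0) -> preserves_constants perturbed.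
Proof.
move=> l0 c; apply/funext => z; rewrite /perturbed l0 mul0r addr0.
exact: opS_cst.
Qed.

Lemma perturbed_pseudometric p :
  0 <= l p -> pseudometric p -> pseudometric (perturbed p).
Proof.
move=> l0 /(opS_pseudometric h)[S0 S1 S2 S3].
have [D0 D1 D2 D3] := dstar_pseudometric X0 dY.
split=> [x y|x|x y|x y z]; rewrite /perturbed.
- by rewrite addr_ge0 ?mulr_ge0.
- by rewrite S1 D1 mulr0 addr0.
- by rewrite S2 D2.
- rewrite addrACA -mulrDr; apply: lerD; first exact: S3.
  by rewrite ler_wpM2l.
Qed.

Hypothesis dX : forall y, ~ X y -> 0 < dist_to d X y.
Hypothesis dmet : forall y y', d (y, y') = 0 -> y = y'.

(** A zero of the sum is a zero of [dstar], hence either an equality or a pair of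
    points of [X], where the operator extends [p]. *)
Lemma perturbed_metric p : 0 < l p -> metric p -> metric (perturbed p).
Proof.
move=> l0 [pp p0]; split; first exact: perturbed_pseudometric (ltW l0) pp.
move=> y y' /eqP; rewrite /perturbed.
have [S0 _ _ _] := opS_pseudometric h pp.
rewrite paddr_eq0 ?mulr_ge0 ?(ltW l0)// mulf_eq0 (gt_eqF l0) /=.
case/andP => /eqP Syy' /eqP; rewrite /dstar /= minEle; case: ifP => [_|_].
  exact: dmet.
move/eqP; rewrite paddr_eq0 ?dist_to_ge0// => /andP[/eqP dy /eqP dy'].
have Xy : X y by apply: contrapT => /dX; rewrite dy ltxx.
have Xy' : X y' by apply: contrapT => /dX; rewrite dy' ltxx.
move: Syy'.
have /= := opS_extension hX p (SigSub (mem_set Xy)) (SigSub (mem_set Xy')).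
by rewrite !set_valE /= => -> /p0 [].
Qed.

(** Outside [X] the term in [dstar] suffices.  At [y] in [X], three bounds by
    [r / 3] are combined: [y] to [h y' t], since [p] dominates the topology of
    [X] and some value of the integrand lies below the average, and twice
    [dist_to d X y'], which bounds the distance from [h y' t] to [y']. *)
Lemma perturbed_dominating p : admissible_metric d ->
  (forall y, ~ X y -> forall x, u y x -> d (set_val x, y) < 2 * dist_to d X y) ->
  0 < l p -> dominating_metric p -> dominating_metric (perturbed p).
Proof.
move=> [dc [_ ddom]] ud l0 [pmet pdom]; split; first exact: perturbed_metric.
have [[p0 _ _ _] _] := pmet.
have [_ d_refl d_sym d_tri] := dY.
have S0 z : 0 <= opS h p z by apply: opS_ge0 => -[].
move=> U oU y Uy; have [r r0 rU] := ddom U oU y Uy.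
have [Xy|nXy] := pselect (X y); last first.
  exists (l p * Num.min r (dist_to d X y)).
    by rewrite mulr_gt0// lt_min r0 dX.
  move=> y' Ty'; apply: rU.
  have : dstar X d (y, y') < Num.min r (dist_to d X y).
    rewrite -(ltr_pM2l l0); apply: le_lt_trans Ty'.
    by rewrite /perturbed lerDr.
  rewrite lt_min => /andP[dr] /(dstar_lt_dist X0 dY) <-.
  exact: dr.
pose x : X := SigSub (mem_set Xy).
have hy : h y = hm_cst R x by rewrite -hX set_valE.
have r30 : 0 < r / 3 by rewrite divr_gt0.
have oB : open [set x' : X | d (y, set_val x') < r / 3].
  apply: (@open_comp _ _ (set_val : X -> Y) [set z | d (y, z) < r / 3]).
    by move=> z _; exact: initial_continuous.
  exact: (open_dist_ball dY dc).
have [|e e0 eB] := pdom _ oB x; first by rewrite /= set_valE /= d_refl.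
exists (Num.min e (l p * (r / 3))); first by rewrite lt_min e0 mulr_gt0.
move=> y'; rewrite lt_min => /andP[Te Tr]; apply: rU.
have dy' : dist_to d X y' < r / 3.
  rewrite -(dstar_to_set X0 dY y' Xy) -(ltr_pM2l l0); apply: le_lt_trans Tr.
  by rewrite /perturbed lerDr.
have [t It pt] : exists2 t, 0 <= t < 1 & p (x, h y' t) < e.
  apply: contrapT => nt; move: Te; rewrite ltNge => /negP; apply.
  apply: (@le_trans _ _ (opS h p (y, y'))).
    apply: opS_ge => t It; rewrite /= hy /= leNgt; apply/negP => pe.
    by apply: nt; exists t.
  by rewrite /perturbed lerDl mulr_ge0// ltW.
have dyx : d (y, set_val (h y' t)) < r / 3 by exact: eB.
have ux := hm_in_u hu y' It.
have [Xy'|nXy'] := pselect (X y').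
  pose x' : X := SigSub (mem_set Xy').
  have hy' : h y' = hm_cst R x' by rewrite -hX set_valE.
  move: dyx; rewrite hy' /= set_valE /= => dyy'; lra.
have := ud y' nXy' _ ux; have := d_tri y (set_val (h y' t)) y'; lra.
Qed.

Lemma perturbed_admissible p : admissible_metric d ->
  (forall y, ~ X y -> forall x, u y x -> d (set_val x, y) < 2 * dist_to d X y) ->
  0 < l p -> admissible_metric p -> admissible_metric (perturbed p).
Proof.
move=> dadm ud l0 [cp pdom]; split; last exact: perturbed_dominating.
by apply: perturbed_continuous cp; case: dadm.
Qed.

End perturbed_operators.

(** * Non-injective choices of h *)

Section noninjective_extension.
Variables (R : realType) (Y : topologicalType) (X : set Y).
Variables (d : Y * Y -> R).
Hypotheses (X0 : X !=set0) (dmet : metric d) (dc : continuous d).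
Hypothesis dX : forall y, ~ X y -> 0 < dist_to d X y.

(** The restriction of [d] to [X] is a metric whose average vanishes on any pair
    of points with the same image under [h]. *)
Lemma noninjective_not_metric (h : Y -> HM R X) :
  ~ injective h -> ~ preserves_metrics (opS h).
Proof.
move=> ninj pres; apply: ninj => y y' hyy'.
pose p (w : X * X) := d (set_val w.1, set_val w.2).
have pm : metric p.
  case: dmet => [[d0 d1 d2 d3] d4]; split; first by split=> * /=; rewrite /p/=.
  by move=> x x' /d4 /val_inj.
have [[_ S1 _ _] S4] := pres p pm.
by apply: S4; rewrite -(S1 y) /opS /= hyy'.
Qed.

Lemma open_dist_gt y r : open [set z | r < d (y, z)].
Proof.
have [dY _] := dmet; have [_ _ d_sym d_tri] := dY.
rewrite openE => z /=; rewrite -subr_gt0 => /(near_dist_lt dY dc z).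
apply: filterS => w; have := d_tri y w z; rewrite (d_sym w) /= => *; lra.
Qed.

(** Near a point [y0] outside [X], overwrite [h y] on [0, phi y) by a fixed
    [x0] in [u y0], where [phi] is a bump with [phi y0 = 1] supported in a small
    ball.  Then [y0] gets the same image as [x0].  Adding [x0] to [u y] on the
    closed ball only keeps [u] upper semicontinuous and, when the ball is small
    enough, keeps the strict inequality that [x0] satisfies at [y0]. *)
Lemma exists_noninjective_extension (u : Y -> set X) (h : Y -> HM R X) :
  X <> setT -> extension_data d u h ->
  exists u' (h' : Y -> HM R X), extension_data d u' h' /\ ~ injective h'.
Proof.
move=> XT [[finu uscu uX] [ch hX hu] ud].
have [dY _] := dmet; have [d0 d_refl d_sym d_tri] := dY.
have [y0 nXy0] : exists y0, ~ X y0.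
  by apply: contrapT => nX; apply: XT; apply/seteqP; split => // y _;
    apply: contrapT => nXy; apply: nX; exists y.
have D0 := dX nXy0; set D := dist_to d X y0 in D0.
pose x0 := h y0 0.
have ux0 : u y0 x0 by apply: (hm_in_u hu); rewrite lexx ltr01.
have [r [r0 rD rm]] : exists r, [/\ 0 < r, r < D &
    metrizable R Y -> d (set_val x0, y0) + 3 * r < 2 * D].
  have [mY|nmY] := pselect (metrizable R Y); last first.
    by exists (D / 2); split => //; lra.
  have := ud mY y0 nXy0 x0 ux0; rewrite -/D => dD.
  (* The slack of the strict inequality at [y0]. *)
  pose g := 2 * D - d (set_val x0, y0).
  exists (Num.min (D / 2) (g / 4)); split => [||_].
  - by rewrite lt_min; apply/andP; split; rewrite /g; lra.
  - by rewrite gt_min; apply/orP; left; lra.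
  - have : Num.min (D / 2) (g / 4) <= g / 4 by rewrite ge_min lexx orbT.
    by rewrite /g => ?; lra.
have far y : X y -> r < d (y0, y).
  by move=> Xy; apply: (lt_le_trans rD); exact: dist_to_le.
pose phi y := 1 - d (y0, y) / r.
have phi_le0 y : r < d (y0, y) -> phi y <= 0.
  by move=> ry; rewrite /phi subr_le0 ler_pdivlMr// mul1r ltW.
have cphi : continuous phi.
  move=> y; apply: cvgB; first exact: cvg_cst.
  apply: cvgM; last exact: cvg_cst.
  have d_y0 : d z @[z --> (y0, y)] --> d (y0, y) by exact: dc.
  apply: (cvg_comp _ _ _ d_y0); apply: cvg_pair; [exact: cvg_cst|exact: cvg_id].
pose u' y := u y `|` [set x | d (y0, y) <= r /\ x = x0].
pose h' y := glue x0 (phi y) (h y).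
exists u', h'; split; last first.
  move=> inj; apply: nXy0.
  have -> : y0 = set_val x0; last exact: set_valP.
  apply: inj; rewrite /h' glue_ge1; last by rewrite /phi d_refl mul0r subr0.
  by rewrite glue_le0 ?hX//; apply/phi_le0/far/set_valP.
split; [split=> [y|U oU|x]|split=> [|x|y x]|].
- rewrite finite_setU; split => //.
  by apply: (sub_finite_set _ (finite_set1 x0)) => x [].
- have [Ux0|nUx0] := pselect (U x0).
    rewrite (_ : [set _ | _] = [set y | u y `<=` U]); first exact: uscu.
    apply/seteqP; split=> y /= uU x; first by move=> ux; apply: uU; left.
    by case=> [/uU|[_ ->]].
  rewrite (_ : [set _ | _] = [set y | u y `<=` U] `&` [set y | r < d (y0, y)]).
    by apply: openI; [exact: uscu|exact: open_dist_gt].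
  apply/seteqP; split=> y /= => [uU|[uU ry] x].
    split; first by move=> x ux; apply: uU; left.
    by rewrite ltNge; apply/negP => dr; apply/nUx0/uU; right.
  by case=> [/uU//|[]]; rewrite leNgt ry.
- rewrite /u' uX; apply/seteqP; split=> x'; last by left.
  by case=> // -[]; rewrite leNgt far//; exact: set_valP.
- exact: continuous_glue.
- by rewrite /h' glue_le0 ?hX//; apply/phi_le0/far/set_valP.
- have [dr|rd] := leP (d (y0, y)) r.
    by move/hm_supp_glue => [->|/hu]; [right|left].
  by rewrite /h' glue_le0 ?phi_le0// => /hu; left.
- move=> mY y nXy x [|[dr ->]]; first exact: ud.
  have := rm mY; have := d_tri (set_val x0) y0 y.
  have := dist_to_lipschitz X0 dY y0 y; rewrite -/D => *; lra.
Qed.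

End noninjective_extension.

(** * The three extension operators *)

Theorem theorem4 (R : realType) (Y : topologicalType) (X : set Y) (a b : X)
    (d : Y * Y -> R) (u : Y -> set X) (h : Y -> HM R X) :
  stratifiable Y -> closed X -> a <> b ->
  metric d -> continuous d -> (forall z, d z <= 1) ->
  (forall y, ~ X y -> 0 < dist_to d X y) ->
  (metrizable R Y -> admissible_metric d) ->
  extension_data d u h ->
  [/\ linear_extension_operator (opS h),
      linear_extension_operator (opS1 a b d h) &
      linear_extension_operator (opS2 a b d h)] /\
  ([/\ positive_operator (opS h), preserves_constants (opS h),
       preserves_bounded (opS h), preserves_continuous (opS h) &
       preserves_pseudometrics (opS h)] /\
   (~ injective h -> ~ preserves_metrics (opS h)) /\
   (X <> setT -> exists (u' : Y -> set X) (h' : Y -> HM R X),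
      extension_data d u' h' /\ ~ preserves_metrics (opS h'))) /\
  ([/\ positive_operator (opS1 a b d h), preserves_bounded (opS1 a b d h),
       preserves_continuous (opS1 a b d h),
       preserves_pseudometrics (opS1 a b d h) &
       preserves_metrics (opS1 a b d h)] /\
   (X <> setT -> ~ preserves_constants (opS1 a b d h))) /\
  ([/\ preserves_constants (opS2 a b d h), preserves_bounded (opS2 a b d h),
       preserves_continuous (opS2 a b d h),
       preserves_pseudometrics (opS2 a b d h) &
       preserves_metrics (opS2 a b d h)] /\
   (X <> setT -> ~ positive_operator (opS2 a b d h))) /\
  (metrizable R Y ->
     [/\ preserves_dominating_metrics (opS1 a b d h),
         preserves_admissible_metrics (opS1 a b d h),
         preserves_dominating_metrics (opS2 a b d h) &
         preserves_admissible_metrics (opS2 a b d h)]).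
Proof.
move=> _ _ ab dmet dc d1 dX madm ext.
have [[finu uscu _] [ch hX hu] ud] := ext.
have [dY d_sep] := dmet.
have X0 : X !=set0 by exists (set_val a); exact: set_valP.
pose l0 (p : X * X -> R) : R := 0.
pose l1 (p : X * X -> R) : R := p (a, b).
pose l2 (p : X * X -> R) : R := p (a, b) - p (a, a).
have -> : opS h = perturbed d h l0.
  by apply/funext => p; apply/funext => z; rewrite /perturbed mul0r addr0.
rewrite -[opS1 a b d h]/(perturbed d h l1) -[opS2 a b d h]/(perturbed d h l2).
pose D : set (X * X) := [set (a, b); (a, a)].
have finD : finite_set D := finite_set2 _ _.
have l2_metric p : metric p -> 0 < l2 p.
  move=> [[p0 p1 _ _] psep]; rewrite /l2 p1 subr0 lt_def p0 andbT.
  by apply/eqP => /psep.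
have l1_metric p : metric p -> 0 < l1 p.
  move=> [[p0 _ _ _] psep]; rewrite /l1 lt_def p0 andbT.
  by apply/eqP => /psep.
have dstar_pos : X <> setT -> exists2 y, ~ X y & 0 < dstar X d (y, set_val b).
  move=> XT; have [y nXy] : exists y, ~ X y.
    by apply: contrapT => nX; apply: XT; apply/seteqP; split => // y _;
      apply: contrapT => nXy; apply: nX; exists y.
  exists y => //; have [_ _ -> _] := dstar_pseudometric X0 dY.
  by rewrite (dstar_to_set X0 dY)//; [exact: dX|exact: set_valP].
split; [|split; [|split; [|split]]].
- split; apply: (perturbed_linear_extension X0 dY d1 finu uscu hX hu finD).
  + by move=> c p q; rewrite /l0 mulr0 addr0.
  + move=> p q e pq; rewrite subrr normr0 mulr_ge0//.
    by apply: le_trans (pq (a, b) _); last by left.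
  + by [].
  + move=> p q e pq; have := pq (a, b) (or_introl erefl); rewrite /l1.
    have := normr_ge0 (p (a, b) - q (a, b)) => *; lra.
  + move=> c p q.
    rewrite [LHS](_ : _ = c * p (a, b) + q (a, b) - (c * p (a, a) + q (a, a)))//.
    by rewrite /l2; ring.
  + move=> p q e pq; have := pq (a, b) (or_introl erefl).
    have := pq (a, a) (or_intror erefl); rewrite /l2 !ler_norml.
    by move=> /andP[? ?] /andP[? ?]; apply/andP; split; lra.
- split; last split.
  + split.
    * by apply: (perturbed_positive h X0 dY) => p _; exact: lexx.
    * by apply: perturbed_constants.
    * exact: (perturbed_bounded h X0 dY d1).
    * exact: (perturbed_continuous X0 dY finu uscu ch hu).
    * by move=> p; exact: perturbed_pseudometric.
  + have <- : opS h = perturbed d h l0.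
      by apply/funext => p; apply/funext => z; rewrite /perturbed mul0r addr0.
    exact: (noninjective_not_metric dmet).
  + move=> XT.
    have [u' [h' [ext' ninj]]] := exists_noninjective_extension X0 dmet dc dX XT ext.
    by exists u', h'; split => //; exact: (noninjective_not_metric dmet).
- split.
  + split.
    * by apply: (perturbed_positive h X0 dY) => p p0; exact: p0.
    * exact: (perturbed_bounded h X0 dY d1).
    * exact: (perturbed_continuous X0 dY finu uscu ch hu).
    * by move=> p pm; apply: perturbed_pseudometric => //; case: pm => p0 _ _ _; exact: p0.
    * by move=> p pm; apply: perturbed_metric => //; exact: l1_metric.
  + move=> /dstar_pos[y _ dy] /(_ 1)/(congr1 (fun f => f (y, set_val b))).
    rewrite /perturbed opS_cst /l1 /= mul1r => /eqP.
    by rewrite -subr_eq0 addrC addKr gt_eqF.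
- split.
  + split.
    * by apply: perturbed_constants => c; rewrite /l2 subrr.
    * exact: (perturbed_bounded h X0 dY d1).
    * exact: (perturbed_continuous X0 dY finu uscu ch hu).
    * move=> p pm; apply: perturbed_pseudometric => //.
      by case: pm => p0 p1 _ _; rewrite /l2 p1 subr0.
    * by move=> p pm; apply: perturbed_metric => //; exact: l2_metric.
  + move=> /dstar_pos[y _ dy] pos.
    (* [p (a, b) = 0] and [p (a, a) = 1], while [opS h p] vanishes at [(y, b)]. *)
    pose p (w : X * X) : R := \1_[set a] w.2.
    have pa x : p (x, a) = 1 by rewrite /p indicE mem_set.
    have pb x : p (x, b) = 0.
      by rewrite /p indicE memNset// => ba; exact: ab (esym ba).
    have p_ge0 w : 0 <= p w by rewrite /p indicE ler0n.
    have := pos p p_ge0 (y, set_val b).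
    have -> : perturbed d h l2 p (y, set_val b) = - dstar X d (y, set_val b).
      rewrite /perturbed /l2 pa pb sub0r mulN1r -[RHS]add0r; congr (_ + _).
      rewrite -[RHS](opS_cst h 0 (y, set_val b)); apply: eq_Rintegral => t _ /=.
      by rewrite hX /= pb.
    by rewrite oppr_ge0 leNgt dy.
- move=> mY; have dadm := madm mY; have ud' := ud mY.
  split=> p pm.
  + apply: (perturbed_dominating X0 dY hX hu dX d_sep dadm ud') => //.
    by apply: l1_metric; case: pm.
  + apply: (perturbed_admissible X0 dY finu uscu ch hX hu dX d_sep dadm ud') => //.
    by apply: l1_metric; case: pm => _ [].
  + apply: (perturbed_dominating X0 dY hX hu dX d_sep dadm ud') => //.
    by apply: l2_metric; case: pm.
  + apply: (perturbed_admissible X0 dY finu uscu ch hX hu dX d_sep dadm ud') => //.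
    by apply: l2_metric; case: pm => _ [].
Qed.
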